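(* Let $\alpha\in(0,1)$ be irrational and $\beta\in(0,1)$. The measure-preserving systems $(I,\mu_I,S)$ and $(\Omega,\mu_\Omega,T)$ are isomorphic.
   Context: $I=[0,1)$ is identified with the circle $\mathbb R/\mathbb Z$ (with its compact topology), and $S:I\to I$, $S(x)=x+\alpha \bmod 1$; $(I,S)$ is strictly ergodic and $\mu_I$ is its unique invariant Borel probability measure. For $\theta\in I$ let $v_\theta\in\{0,1\}^{\mathbb Z}$, $v_\theta(n)=\chi_{[1-\beta,1)}(\alpha n+\theta \bmod 1)$. The set $\{0,1\}^{\mathbb Z}$ carries the product topology and $T$ is the shift $(Tu)(n)=u(n+1)$. Put $$\Omega=\{\omega\in\{0,1\}^{\mathbb Z}:\omega=\lim_{i\to\infty}T^{n_i}v_0\text{ for some sequence }n_i\to\infty\}.$$ $(\Omega,T)$ is strictly ergodic and $\mu_\Omega$ is its unique invariant Borel probability measure. Two measure-preserving systems $(M_i,\mu_i,S_i)$, $i=1,2$ ($M_i$ a measure space, $\mu_i$ a measure on $M_i$, $S_i$ a measure-preserving map on $M_i$) are called isomorphic if there exist invariant subsets $\tilde M_i\subseteq M_i$ of full measure and a bijective, bimeasurable, measure-preserving map $\phi:\tilde M_1\to\tilde M_2$ with $\phi\circ S_1=S_2\circ\phi$ on $\tilde M_1$. *)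

(* Defs.v *)
From HB Require Import structures.
From mathcomp Require Import all_boot all_order all_algebra.
From mathcomp Require Import generic_quotient.
From mathcomp Require Import all_classical all_reals all_analysis.

Set Implicit Arguments.
Unset Strict Implicit.
Unset Printing Implicit Defensive.

Import Order.TTheory GRing.Theory Num.Theory.
Import numFieldNormedType.Exports.

Local Open Scope classical_set_scope.
Local Open Scope ring_scope.
Local Open Scope quotient_scope.

(* The space [X] with its Borel sigma-algebra. *)
Notation borel X := (g_sigma_algebraType (@open X)).

Lemma continuous_borel_measurable (X Y : ptopologicalType) (f : X -> Y) :
  continuous f -> measurable_fun setT (f : borel X -> borel Y).
Proof.
move=> /continuousP cf.
apply: (@measurability _ _ (borel X) (borel Y) setT f (@open Y)) => //.
by move=> _ [B oB <-]; rewrite setTI; apply: sub_gen_smallest; exact: cf.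
Qed.

Section systems.
Context d (M : measurableType d) (R : realType).

Definition measure_preserving (mu : {measure set M -> \bar R}) (S : M -> M) :=
  measurable_fun setT S /\
  forall A, measurable A -> mu (S @^-1` A) = mu A.

(* [mu] is the unique S-invariant probability. Measurability of [S], required by
   [measure_preserving], holds for the two maps below: [measurable_rotation],
   [measurable_sturmian_shift]. *)
Definition unique_invariant_probability (mu : probability M R) (S : M -> M) :=
  measure_preserving mu S /\
  forall nu : probability M R, measure_preserving nu S ->
    forall A, measurable A -> nu A = mu A.

(* Invariance is forward invariance, S N <= N, which is what makes
   [phi \o S1 = S2 \o phi] on N1 meaningful for [phi : N1 -> N2]. *)
Definition invariant_of_full_measure
    (mu : {measure set M -> \bar R}) (S : M -> M) (N : set M) :=
  [/\ measurable N, S @` N `<=` N & mu (~` N) = 0%E].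

End systems.

(* The map [phi : N1 -> N2] is given as a total function of which only the
   restriction to [N1] matters; being measurable types, the spaces are
   nonempty, so every map [N1 -> N2] extends. *)
Definition isomorphic_systems (R : realType) d1 d2
    (M1 : measurableType d1) (M2 : measurableType d2)
    (mu1 : {measure set M1 -> \bar R}) (S1 : M1 -> M1)
    (mu2 : {measure set M2 -> \bar R}) (S2 : M2 -> M2) :=
  exists (N1 : set M1) (N2 : set M2) (phi : M1 -> M2),
    [/\ invariant_of_full_measure mu1 S1 N1,
        invariant_of_full_measure mu2 S2 N2 &
        set_bij N1 N2 phi] /\
    [/\ measurable_fun N1 phi,
        (forall A, measurable A -> A `<=` N1 -> measurable (phi @` A)),
        (forall B, measurable B -> B `<=` N2 ->
           mu1 (N1 `&` phi @^-1` B) = mu2 B) &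
        (forall x, N1 x -> phi (S1 x) = S2 (phi x))].

Definition mod1 (R : realType) (x : R) : R := x - (Num.floor x)%:~R.

Lemma mod1_itv (R : realType) (x : R) : 0 <= mod1 x < 1.
Proof.
rewrite subr_ge0 floor_le/= ltrBlDl.
by have := floorD1_gt x; rewrite intrD.
Qed.

Lemma mod1_id (R : realType) (x : R) : 0 <= x < 1 -> mod1 x = x.
Proof. by move=> x01; rewrite /mod1 (@floor_def _ x 0) ?subr0. Qed.

Lemma mod1D (R : realType) (x y : R) : mod1 (mod1 x + y) = mod1 (x + y).
Proof.
rewrite /mod1; set n := Num.floor x.
have -> : x - n%:~R + y = x + y + (- n)%:~R by rewrite addrAC mulrNz.
rewrite floorDrz ?intr_int// intrKfloor intrD opprD addrACA.
by rewrite subrr addr0.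
Qed.

Definition unit_itv (R : realType) : Type := {x : R | 0 <= x < 1}.

Definition unit_itv_pi (R : realType) (x : R) : unit_itv R :=
  exist _ (mod1 x) (mod1_itv x).

Lemma unit_itv_piK (R : realType) :
  cancel (fun x : unit_itv R => val x) (@unit_itv_pi R).
Proof. by case=> x x01; apply: val_inj => /=; rewrite mod1_id. Qed.

HB.instance Definition _ (R : realType) :=
  isQuotient.Build R (unit_itv R) (@unit_itv_piK R).

(* [0, 1) with the topology of R/Z, i.e. the quotient topology of R -> [0, 1);
   [\pi] is reduction mod 1 and [repr] is the inclusion of [0, 1) in R. *)
Notation circle R := (quotient_topology (unit_itv R)).

Lemma repr_pi_circle (R : realType) (x : R) : repr (\pi_(circle R) x) = mod1 x.
Proof. by rewrite !unlock. Qed.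

Definition rotation (R : realType) (alpha : R) (x : circle R) : circle R :=
  \pi_(circle R) (repr x + alpha).

Lemma rotation_continuous (R : realType) (alpha : R) :
  continuous (@rotation R alpha).
Proof.
apply/quotient_continuous.
have -> : @rotation R alpha \o \pi_(circle R) =
    \pi_(circle R) \o (fun x => x + alpha).
  apply/funext => x /=; rewrite /rotation repr_pi_circle.
  by rewrite -[LHS]reprK -[RHS]reprK !repr_pi_circle mod1D.
move=> x; apply: continuous_comp; last exact: pi_continuous.
by apply: cvgD; [exact: cvg_id|exact: cvg_cst].
Qed.

Notation biseq := {ptws int -> bool}.

Lemma biseq_cvg (F : set_system biseq) (u : biseq) : Filter F ->
  (forall n, (fun v : biseq => v n) @ F --> u n) -> F --> u.
Proof.
move=> FF cv; apply/cvg_sup => n U [V [[W oW <-] Wu] VU].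
by apply: filterS VU _; apply: cv; exact: open_nbhs_nbhs.
Qed.

Definition shift (u : biseq) : biseq := fun n : int => u (n + 1).

Lemma shift_continuous : continuous shift.
Proof.
move=> u; apply: biseq_cvg => n.
exact: (@proj_continuous int (fun=> bool) (n + 1)).
Qed.

Definition coding (R : realType) (alpha beta : R) (theta : circle R) : biseq :=
  fun n : int => mod1 (alpha * n%:~R + repr theta) \in `[1 - beta, 1[.

(* The shift is iterated a natural number of times, and [n @ \oo --> \oo] means
   that the exponents tend to +oo. *)
Definition omega_limit_set (u : biseq) : set biseq :=
  [set w | exists2 n : nat -> nat, n @ \oo --> \oo &
     (fun i => iter (n i) shift u) @ \oo --> w].

Lemma omega_limit_set_shift (u w : biseq) :
  omega_limit_set u w -> omega_limit_set u (shift w).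
Proof.
move=> [n noo nw]; exists (fun i => (n i).+1).
  move=> A [N _ NA]; have [M _ MN] := noo _ (nbhs_infty_ge N).
  by exists M => // i /= /MN Ni; apply: NA => /=; exact: leqW.
exact: (cvg_comp _ _ nw (@shift_continuous w)).
Qed.

Lemma omega_limit_set_nonempty (u : biseq) : omega_limit_set u !=set0.
Proof.
have cT : compact [set: biseq].
  have := @tychonoff _ (fun _ : int => _) _ (fun=> bool_compact).
  by congr (compact _); rewrite eqEsubset.
pose x := (fun i => iter i shift u) : nat -> biseq.
have [w [_ wx]] := cT (x @ \oo) _ filterT.
pose V k := [set v : biseq | forall m : nat, (m < k)%N ->
  forall j : int, unpickle m = Some j -> v j = w j].
have nV k : nbhs w (V k).
  elim: k => [|k IH]; first by apply: filterS filterT => v _ m.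
  pose W := [set v : biseq | forall j : int, unpickle k = Some j -> v j = w j].
  have nW : nbhs w W.
    rewrite /W; case: (unpickle k) => [j|]; last first.
      by apply: filterS filterT => v _ j.
    have H := @proj_continuous int (fun=> bool) j w _ (discrete_set1 (w j)).
    by apply: (@filterS _ (nbhs w) _ _ _ _ H) => v /= vj _ [<-].
  apply: filterS (filterI IH nW) => v [Vv Wv] m.
  by rewrite ltnS leq_eqVlt => /predU1P[->|/Vv].
have /choice[n nP] : forall k, exists n, (k <= n)%N /\ V k (x n).
  move=> k.
  have xk : (x @ \oo) (x @` [set n | (k <= n)%N]).
    by exists k => // n /= kn; exists n.
  by have [_ [[n kn <-] Vn]] := wx _ _ xk (nV k); exists n.
exists w; exists n.
  move=> A [N _ NA]; exists N => // k /= Nk; apply: NA => /=.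
  by apply: leq_trans Nk _; have [] := nP k.
apply: biseq_cvg => j.
apply: cvg_near_cst; exists (pickle j).+1 => // k /= jk.
by have [_ /(_ _ jk j (pickleK j))] := nP k.
Qed.

Definition sturmian (R : realType) (alpha beta : R) : set biseq :=
  omega_limit_set (coding alpha beta (\pi_(circle R) 0)).

(* The space Omega, with the topology induced by {0,1}^Z. *)
Definition sturmian_space (R : realType) (alpha beta : R) : Type :=
  set_type (sturmian alpha beta).

HB.instance Definition _ (R : realType) (alpha beta : R) :=
  Topological.copy (sturmian_space alpha beta) (set_type (sturmian alpha beta)).

Lemma sturmian_space_inhabited (R : realType) (alpha beta : R) :
  exists w : sturmian_space alpha beta, True.
Proof.
have [w ww] := omega_limit_set_nonempty (coding alpha beta (\pi_(circle R) 0)).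
by exists (exist _ w (mem_set ww)).
Qed.

HB.instance Definition _ (R : realType) (alpha beta : R) :=
  isPointed.Build (sturmian_space alpha beta)
    (projT1 (cid (sturmian_space_inhabited alpha beta))).

Definition sturmian_shift (R : realType) (alpha beta : R)
    (w : sturmian_space alpha beta) : sturmian_space alpha beta :=
  exist _ (shift (val w)) (mem_set (omega_limit_set_shift (set_mem (valP w)))).

Lemma sturmian_shift_continuous (R : realType) (alpha beta : R) :
  continuous (@sturmian_shift R alpha beta).
Proof.
have cval : continuous (val : sturmian_space alpha beta -> biseq).
  exact: initial_continuous.
apply/continuousP => _ [W oW <-]; rewrite -comp_preimage.
have -> : val \o @sturmian_shift R alpha beta = shift \o val by [].
by move: W oW; apply/continuousP => w; apply: continuous_comp (cval w) _;
  exact: shift_continuous.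
Qed.

Lemma measurable_rotation (R : realType) (alpha : R) :
  measurable_fun setT (rotation alpha : borel (circle R) -> borel (circle R)).
Proof. by apply: continuous_borel_measurable; exact: rotation_continuous. Qed.

Lemma measurable_sturmian_shift (R : realType) (alpha beta : R) :
  measurable_fun setT (@sturmian_shift R alpha beta :
    borel (sturmian_space alpha beta) -> borel (sturmian_space alpha beta)).
Proof.
by apply: continuous_borel_measurable; exact: sturmian_shift_continuous.
Qed.

(* Main.v *)
(* The coding phi : theta |-> v_theta satisfies phi S = T phi. Since [1 - beta, 1)
   is closed on the left, v_theta = lim T^(n_i) v_0 whenever alpha n_i tends to
   theta from the right, so phi maps all of I into Omega. The left endpoints
   -beta - alpha n of the arcs {v_theta(n) = 1} being dense, a word
   v_theta(n) = 1, v_theta(m) = 0 forces any lower bound q < theta; hence the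
   lower limit of theta' as v_theta' tends to w is a function of w inverting phi,
   and it is Borel because it is lower semicontinuous. A Borel left inverse
   makes phi(I) and the images of Borel sets Borel, and unique ergodicity of
   Omega identifies the image of mu_I with mu_Omega. *)

Require Import Defs.
From mathcomp Require Import all_boot all_order all_algebra.
From mathcomp Require Import generic_quotient.
From mathcomp Require Import all_classical all_reals all_analysis.
From mathcomp Require Import measurable_realfun ring lra.

Set Implicit Arguments.
Unset Strict Implicit.
Unset Printing Implicit Defensive.

Import Order.TTheory GRing.Theory Num.Theory.
Import numFieldNormedType.Exports.
Local Open Scope classical_set_scope.
Local Open Scope ring_scope.
Local Open Scope quotient_scope.

(** * Reduction mod 1 and one-sided density of irrational orbits *)

Lemma mod1Dz (R : realType) (x : R) (m : int) : mod1 (x + m%:~R) = mod1 x.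
Proof.
rewrite /mod1 floorDrz ?intr_int// intrKfloor intrD opprD.
by rewrite addrACA subrr addr0.
Qed.

Lemma mod1_eq (R : realType) (x y : R) (m : int) :
  x = y + m%:~R -> 0 <= y < 1 -> mod1 x = y.
Proof. by move=> ->; rewrite mod1Dz; exact: mod1_id. Qed.

Lemma mod1_mulrn (R : realType) (x : R) (n : nat) :
  mod1 (mod1 x * n%:R) = mod1 (x * n%:R).
Proof.
rewrite {2}/mod1 mulrBl -[n%:R in X in _ - X]/(n%:Z%:~R) -intrM.
by rewrite -mulrNz mod1Dz.
Qed.

Lemma mod1_gt0 (R : realType) (alpha : R) (n : nat) :
  irrational alpha -> (0 < n)%N -> 0 < mod1 (alpha * n%:R).
Proof.
move=> irr n0; have /andP[ge0 _] := mod1_itv (alpha * n%:R).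
rewrite lt_def ge0 andbT; apply/eqP => /subr0_eq E; apply: irr.
exists ((Num.floor (alpha * n%:R))%:~R / n%:R) => //.
rewrite fmorph_div/= ratr_int ratr_nat -E mulfK//.
by rewrite pnatr_eq0 -lt0n.
Qed.

(* If t = mod1 (alpha k) does not divide 1, then the least multiple of t beyond
   1 exceeds 1 by t' <= t / 2, or else t - t' < t / 2 is a backward step of the
   orbit, which can be subtracted from t until what remains is below it. *)
Lemma halve_rotation_step (R : realType) (alpha : R) (k : nat) :
  irrational alpha -> (0 < k)%N ->
  exists2 l, (0 < l)%N & mod1 (alpha * l%:R) <= mod1 (alpha * k%:R) / 2.
Proof.
move=> irr k0; set t := mod1 _.
have t0 : 0 < t by exact: mod1_gt0.
have /andP[_ t1] : 0 <= t < 1 by exact: mod1_itv.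
have orbit l : mod1 (alpha * (k * l)%:R) = mod1 (t * l%:R).
  by rewrite mod1_mulrn natrM mulrA.
have /truncn_itv /andP[] : 0 <= t^-1 by rewrite invr_ge0 ltW.
set j := Num.truncn _.
rewrite -[_ <= _](ler_pM2l t0) -(ltr_pM2l t0) mulfV ?gt_eqF//.
rewrite -natr1 => jl jr.
have j0 : (0 < j)%N by case: j jr {jl} => //; rewrite mulrDr; lra.
have [le|gt] := leP (t * (j%:R + 1) - 1) (t / 2).
  exists (k * j.+1)%N; first by rewrite muln_gt0 k0.
  rewrite orbit (@mod1_eq _ _ (t * (j%:R + 1) - 1) 1)//; last lra.
  by rewrite -natr1 subrK.
have [s0|s0] := eqVneq (t * j%:R) 1.
  exists (k * j)%N; first by rewrite muln_gt0 k0.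
  by rewrite orbit (@mod1_eq _ _ 0 1)//; [lra|rewrite add0r|rewrite lexx/=].
have {}s0 : 0 < 1 - t * j%:R by rewrite subr_gt0 lt_neqAle s0.
have /truncn_itv /andP[] : 0 <= t / (1 - t * j%:R) by rewrite ltW// divr_gt0.
set i := Num.truncn _; rewrite ler_pdivlMr// ltr_pdivrMr// -natr1 => il ir.
exists (k * (1 + i * j))%N; first by rewrite muln_gt0 k0.
rewrite orbit (@mod1_eq _ _ (t - i%:R * (1 - t * j%:R)) i)//.
- lra.
- by rewrite natrD natrM -[i%:~R]/(i%:R); ring.
- lra.
Qed.

(** Iterated halving, starting from the trivial bound 1 at [k = 1]. *)
Lemma small_rotation_step (R : realType) (alpha eps : R) :
  irrational alpha -> 0 < eps ->
  exists2 k, (0 < k)%N & mod1 (alpha * k%:R) < eps.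
Proof.
move=> irr e0.
have H n : exists2 k, (0 < k)%N & mod1 (alpha * k%:R) <= 2 ^- n.
  elim: n => [|n [k k0 kn]].
    exists 1%N => //; rewrite expr0 invr1 ltW//.
    by have /andP[] := mod1_itv (alpha * 1%:R).
  have [l l0 lk] := halve_rotation_step irr k0; exists l => //.
  by apply: le_trans lk _; rewrite exprSr invfM ler_wpM2r.
have [k k0 kn] := H (Num.truncn eps^-1).+1; exists k => //.
apply: le_lt_trans kn _; rewrite invf_plt ?posrE ?exprn_gt0//.
apply: lt_trans (truncnS_gt _) _.
by rewrite -natrX ltr_nat ltn_expl.
Qed.

(** Multiples of a step [t < eps] cannot skip the arc of length [eps] to the right of [x]. The
    half-open coding interval requires approach from this side. *)
Lemma rotation_dense (R : realType) (alpha x eps : R) (N : nat) :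
  irrational alpha -> 0 < eps ->
  exists2 n, (N <= n)%N & mod1 (alpha * n%:R - x) < eps.
Proof.
move=> irr e0.
have [k k0 ke] := small_rotation_step irr e0.
set t := mod1 _ in ke.
have t0 : 0 < t by exact: mod1_gt0.
have /andP[_ t1] : 0 <= t < 1 by exact: mod1_itv.
(* Moving [x] by [m] to at least [N] makes the index large: since [t < 1], the first multiple of [t]
   beyond [x + m] has a factor exceeding [N]. *)
pose m : int := Num.ceil (N%:R - x).
have mN : N%:R <= x + m%:~R by rewrite -lerBlDl ceil_ge.
have y0 : 0 <= x + m%:~R by apply: le_trans mN.
have /truncn_itv /andP[] : 0 <= (x + m%:~R) / t by rewrite divr_ge0// ltW.
set i := Num.truncn _; rewrite ler_pdivlMr// ltr_pdivrMr// -natr1 => il ir.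
exists (k * i.+1)%N.
  apply: leq_trans (leq_pmull _ k0).
  rewrite -(ler_nat R) -natr1; apply: le_trans mN (ltW (lt_le_trans ir _)).
  by rewrite ler_piMr ?ltW// natr1.
rewrite natrM mulrA.
have -> : mod1 (alpha * k%:R * i.+1%:R - x) = mod1 (t * i.+1%:R - x).
  by rewrite -mod1D -mod1_mulrn mod1D.
rewrite (@mod1_eq _ _ (t * i.+1%:R - x - m%:~R) m) ?subrK// -natr1; lra.
Qed.

(** * Borel measurability on the circle and on the sequence space *)

Lemma lower_semicontinuous_borel_measurable (X : ptopologicalType)
    (R : realType) (f : X -> R) :
  (forall c, open [set x | c < f x]) -> measurable_fun setT (f : borel X -> R).
Proof.
move=> of_; apply: (measurability _ (RGenOInfty.measurableE R)).
move=> _ [_ [c ->] <-]; rewrite setTI preimage_itvoy.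
exact: sub_sigma_algebra.
Qed.

(* mod1 jumps downwards at the integers only. *)
Lemma open_mod1_gt (R : realType) (c : R) : open [set x : R | c < mod1 x].
Proof.
have [c0|c0] := ltP c 0.
  rewrite (_ : [set x | _] = setT); first exact: openT.
  by apply/seteqP; split=> // x _; have /andP[/(lt_le_trans c0)] := mod1_itv x.
rewrite (_ : [set x | _] =
    \bigcup_(m in [set: int]) `]m%:~R + c, m%:~R + 1[%classic).
  by apply: bigcup_open => m _; exact: itv_open.
apply/seteqP; split=> [x /= cx|x [m _]].
  exists (Num.floor x) => //=; rewrite in_itv/=.
  by have := mod1_itv x; move: cx; rewrite /mod1; lra.
rewrite /= in_itv/= => /andP[mx xm].
by rewrite (@mod1_eq _ _ (x - m%:~R) m) ?subrK//; lra.
Qed.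

(** [repr] is discontinuous only at the point 0, where it drops to its least value; so it is lower
    semicontinuous. *)
Lemma measurable_circle_repr (R : realType) :
  measurable_fun setT (repr : borel (circle R) -> R).
Proof.
apply: lower_semicontinuous_borel_measurable => c.
change (open (\pi_(circle R) @^-1` [set x | c < repr x])).
rewrite (_ : _ @^-1` _ = [set x | c < mod1 x]); first exact: open_mod1_gt.
by apply/seteqP; split=> x /=; rewrite repr_pi_circle.
Qed.

Lemma measurable_coding (R : realType) (alpha beta : R) (n : int) :
  measurable_fun setT
    (fun theta : borel (circle R) => coding alpha beta theta n).
Proof.
(* Symbol [n] tests whether [repr] of the point rotated by [alpha * n] lies in a fixed interval. *)
have mr := measurableT_comp (@measurable_circle_repr R)
  (@measurable_rotation R (alpha * n%:~R)).
apply: (measurable_fun_bool true); rewrite setTI.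
have := mr measurableT _ (measurable_itv `[1 - beta, 1[); rewrite setTI.
congr (measurable _); apply/seteqP; split => theta /=;
  by rewrite /coding /rotation repr_pi_circle addrC => ->.
Qed.

Definition cylinder (s : seq (int * bool)) : set biseq :=
  [set u | forall p, p \in s -> u p.1 = p.2].

Lemma open_biseq_cylinder (W : set biseq) (w : biseq) : open W -> W w ->
  exists s, cylinder s w /\ cylinder s `<=` W.
Proof.
move=> oW Ww.
(* The filter generated by the cylinders at [w] converges to [w] coordinatewise, hence in the
   product topology, so it contains [W]. *)
pose F : set_system biseq :=
  [set A | exists s, cylinder s w /\ cylinder s `<=` A].
have FF : Filter F.
  split.
  - by exists [::].
  - move=> A B [s [sw sA]] [t [tw tB]]; exists (s ++ t); split.
      by move=> p; rewrite mem_cat => /orP[/sw|/tw].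
    move=> u us; split; [apply: sA|apply: tB] => p ps; apply: us;
      by rewrite mem_cat ps ?orbT.
  - by move=> A B AB [s [sw sA]]; exists s; split => //; exact: subset_trans AB.
suff /(_ W) : F --> w by apply; exact: open_nbhs_nbhs.
apply: biseq_cvg => n A /nbhs_singleton Awn.
exists [:: (n, w n)]; split=> [p|u /(_ (n, w n))].
  by rewrite inE => /eqP ->.
by rewrite inE eqxx /= => /(_ isT) ->.
Qed.

(** Cylinders are indexed by finite lists, so there are countably many, and [W] is the union of
    those it contains. *)
Lemma measurable_biseq d (T : measurableType d) (f : T -> biseq)
    (W : set biseq) :
  (forall n, measurable_fun setT (fun x => f x n)) -> open W ->
  measurable (f @^-1` W).
Proof.
move=> mf oW.
rewrite (_ : _ @^-1` _ = \bigcup_s (if `[< cylinder s `<=` W >]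
    then f @^-1` cylinder s else set0)).
  apply: countable_bigcupT_measurable; first exact: countableP.
  move=> s; case: ifP => // _.
  rewrite (_ : _ @^-1` _ =
      \big[setI/setT]_(p <- s) [set x | f x p.1 = p.2]); last first.
    by rewrite -bigcap_seq; apply/seteqP; split=> x /= H p /=; apply: H.
  apply: big_ind => //; first exact: measurableI.
  by move=> p _; have := mf p.1 measurableT [set p.2]; rewrite setTI; apply.
apply/seteqP; split=> [x Wx|x [s _]]; last first.
  by case: asboolP => // sW; exact: sW.
have [s [sx sW]] := open_biseq_cylinder oW Wx.
by exists s => //; case: asboolP.
Qed.

Lemma measurable_sturmian (R : realType) (alpha beta : R) d
    (T : measurableType d) (f : T -> sturmian_space alpha beta) :
  (forall n, measurable_fun setT (fun x => val (f x) n)) ->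
  measurable_fun setT (f : T -> borel (sturmian_space alpha beta)).
Proof.
move=> mf; apply: (@measurability _ _ _ (borel (sturmian_space alpha beta))
  setT f (@open (sturmian_space alpha beta))) => //.
move=> _ [_ [W oW <-] <-]; rewrite setTI -comp_preimage.
exact: measurable_biseq.
Qed.

Lemma open_sturmian_coord (R : realType) (alpha beta : R) (n : int) (b : bool) :
  open [set w : sturmian_space alpha beta | val w n = b].
Proof.
exists [set u : biseq | u n = b] => //.
rewrite (_ : [set u | _] = (fun u : biseq => u n) @^-1` [set b])//.
apply: open_comp; last exact: discrete_open.
by move=> u _; exact: (@proj_continuous int (fun=> bool) n).
Qed.

Lemma measurable_sturmian_coord (R : realType) (alpha beta : R) (n : int) :
  measurable_fun setT
    (fun w : borel (sturmian_space alpha beta) => val w n).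
Proof.
apply: (measurable_fun_bool true); rewrite setTI.
by apply: sub_sigma_algebra; exact: open_sturmian_coord.
Qed.

Lemma measurable_neq_bool d (T : measurableType d) (f g : T -> bool) :
  measurable_fun setT f -> measurable_fun setT g ->
  measurable [set x | f x <> g x].
Proof.
move=> mf mg; rewrite (_ : [set x | _] =
    (f @^-1` [set true] `&` g @^-1` [set false]) `|`
    (f @^-1` [set false] `&` g @^-1` [set true])).
  by apply: measurableU; apply: measurableI; rewrite -[_ @^-1` _]setTI;
    [exact: mf|exact: mg|exact: mf|exact: mg].
apply/seteqP; split=> x /=; case: (f x) (g x) => [] [] //=; try by [left|right].
- by case=> -[].
- by case=> -[].
Qed.

(** * A Borel left inverse defined as a lower limit *)

Section lower_limit_inverse.
Context (T : Type) (X : ptopologicalType) (R : realType).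
Variables (phi : T -> X) (h : T -> R).
Hypothesis h01 : forall t, 0 <= h t < 1.

(** Off the closure of the range of [phi] every real would be a lower bound; [q < 1] keeps the set
    bounded there and excludes nothing on the range, where [h < 1]. *)
Definition lower_bounds_near (w : X) : set R :=
  [set q | q < 1 /\ exists U, [/\ open U, U w &
     forall t, U (phi t) -> q <= h t]].

(* The lower limit of h t as phi t tends to w (capped at 1). *)
Definition lower_limit_inverse (w : X) : R := sup (lower_bounds_near w).

Let nonempty w : lower_bounds_near w !=set0.
Proof.
exists 0; split => //; exists setT; split=> // [|t _]; first exact: openT.
by have /andP[] := h01 t.
Qed.

Let bounded w : has_ubound (lower_bounds_near w).
Proof. by exists 1 => q [/ltW]. Qed.

Lemma measurable_lower_limit_inverse :
  measurable_fun setT (lower_limit_inverse : borel X -> R).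
Proof.
apply: lower_semicontinuous_borel_measurable => c.
(* A neighbourhood [U] witnessing [q] at [w] witnesses it at each of its points. *)
rewrite openE => w /= /(sup_gt (nonempty w))[q [q1 [U [oU Uw Uq]]] cq].
apply: filterS (open_nbhs_nbhs (conj oU Uw)) => v Uv /=.
apply: lt_le_trans cq _; apply: ub_le_sup; first exact: bounded.
by split=> //; exists U.
Qed.

Lemma lower_limit_inverseK (t : T) :
  (forall q, q < h t -> exists U, [/\ open U, U (phi t) &
     forall s, U (phi s) -> q <= h s]) ->
  lower_limit_inverse (phi t) = h t.
Proof.
move=> sep; apply/eqP; rewrite eq_le; apply/andP; split.
  by apply: ge_sup (nonempty _) _ => q [_ [U [_ /[swap]]]]; exact.
rewrite leNgt; apply/negP => lt.
suff : lower_bounds_near (phi t) ((lower_limit_inverse (phi t) + h t) / 2).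
  by move=> /(ub_le_sup (bounded _)); rewrite -/(lower_limit_inverse _); lra.
split; first by have := h01 t; lra.
by apply: sep; lra.
Qed.

End lower_limit_inverse.

(** * Codings of circle points: equivariance, membership in Omega, separation *)

Lemma circle_repr_itv (R : realType) (theta : circle R) : 0 <= repr theta < 1.
Proof. by rewrite -[theta]reprK repr_pi_circle; exact: mod1_itv. Qed.

Lemma coding_rotation (R : realType) (alpha beta : R) (theta : circle R) :
  coding alpha beta (rotation alpha theta) =
    Defs.shift (coding alpha beta theta).
Proof.
apply/funext => n; rewrite /Defs.shift /coding /rotation repr_pi_circle.
rewrite [_ + mod1 _]addrC mod1D intrD mulrDr mulr1.
have -> : repr theta + alpha + alpha * n%:~R =
    alpha * n%:~R + alpha + repr theta by ring.
by done.
Qed.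

Lemma iter_shiftE (k : nat) (u : biseq) (n : int) :
  iter k Defs.shift u n = u (n + k%:Z).
Proof.
elim: k n => [|k IH] n; first by rewrite addr0.
by rewrite iterS /Defs.shift IH -addrA intS.
Qed.

Lemma coding_in_sturmian (R : realType) (alpha beta : R) (theta : circle R) :
  irrational alpha -> sturmian alpha beta (coding alpha beta theta).
Proof.
move=> irr.
have /choice[k kP] : forall i : nat, exists n : nat,
    (i <= n)%N /\ mod1 (alpha * n%:R - repr theta) < i.+1%:R^-1.
  move=> i; have i0 : 0 < (i.+1%:R : R)^-1 by rewrite invr_gt0.
  by have [n] := rotation_dense (repr theta) i irr i0; exists n.
exists k.
  move=> A [N _ NA]; exists N => // i /= Ni; apply: NA => /=.
  by apply: leq_trans Ni _; have [] := kP i.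
apply: biseq_cvg => n; apply: cvg_near_cst.
pose y := mod1 (alpha * n%:~R + repr theta).
have /andP[y0 y1] : 0 <= y < 1 by exact: mod1_itv.
(* A lower bound for the distance from [y] rightwards to the next possible change of symbol. It is
   positive even at an endpoint, as the interval is closed on the left. *)
pose delta := if 1 - beta <= y then 1 - y else Num.min (1 - y) (1 - beta - y).
have d0 : 0 < delta.
  by rewrite /delta; case: (leP (1 - beta) y) => ?; rewrite ?lt_min; lra.
exists (Num.truncn delta^-1) => // i /= di.
have [_ ei] := kP i; set e := mod1 _ in ei.
have /andP[e0 _] : 0 <= e < 1 by exact: mod1_itv.
have ed : e < delta.
  apply: lt_trans ei _; rewrite invf_plt ?posrE//.
  by apply: lt_le_trans (truncnS_gt _) _; rewrite ler_nat.
rewrite iter_shiftE /coding repr_pi_circle -/y.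
have -> : mod1 (alpha * (n + k i)%:~R + mod1 0) = y + e.
  (* The integer parts dropped in [y] and in [e]. *)
  pose m := Num.floor (alpha * n%:~R + repr theta) +
            Num.floor (alpha * (k i)%:R - repr theta).
  apply: (@mod1_eq _ _ _ m).
    rewrite mod1_id ?lexx ?ltr01// addr0 /y /e /mod1 /m !intrD mulrDr.
    by rewrite -[(k i)%:~R]/((k i)%:R); ring.
  move: ed; rewrite /delta.
  by case: (leP (1 - beta) y) => ?; rewrite ?lt_min; lra.
rewrite !in_itv/=; apply/idP/idP; move: ed; rewrite /delta;
  by case: (leP (1 - beta) y) => ?; rewrite ?lt_min; lra.
Qed.

(* The disjuncts are the two pieces into which the point 0 may cut the arc of
   length [beta] starting at [a]. *)
Lemma codingE (R : realType) (alpha beta : R) (theta : circle R) (n : int)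
    (a := mod1 (- beta - alpha * n%:~R)) : 0 < beta < 1 ->
  coding alpha beta theta n =
    (repr theta < a - 1 + beta) || (a <= repr theta < a + beta).
Proof.
move=> b01; have t01 := circle_repr_itv theta.
have a01 : 0 <= a < 1 by exact: mod1_itv.
pose m := Num.floor (- beta - alpha * n%:~R).
have E (k : int) : 0 <= repr theta - a - beta + k%:~R < 1 ->
    mod1 (alpha * n%:~R + repr theta) = repr theta - a - beta + k%:~R.
  by apply: (@mod1_eq _ _ _ (- m - k)); rewrite /a /mod1 -/m intrB mulrNz; ring.
have ab01 : 0 <= a < 1 by [].
rewrite /coding in_itv /=; apply/idP/idP.
  move=> cn; have [lt1|ge1] := ltP (repr theta) (a - 1 + beta) => //=.
  have [lt2|ge2] := ltP (repr theta) a.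
    by move: cn; rewrite (E 1) mulr1z; lra.
  have [//|ge3] := ltP (repr theta) (a + beta).
  by move: cn; rewrite (E 0) mulr0z; lra.
move=> /orP[lt1|/andP[ge2 lt3]].
  by rewrite (E 2); rewrite -[2%:~R]/(2 : R); lra.
by rewrite (E 1) mulr1z; lra.
Qed.

Lemma coding_endpoints_dense (R : realType) (alpha beta x y : R) :
  irrational alpha -> 0 <= x -> x < y -> y <= 1 ->
  exists n : int, x < mod1 (- beta - alpha * n%:~R) < y.
Proof.
move=> irr x0 xy y1.
have d0 : 0 < (y - x) / 2 by lra.
(* The orbit is sent just to the right of the midpoint of [x] and [y], by less than half the gap;
   the sign of [n] is then reversed to match the endpoint formula. *)
have [n _ nd] := rotation_dense (beta + (x + y) / 2) 0 irr d0.
exists (- n%:Z).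
have := mod1_itv (alpha * n%:R - (beta + (x + y) / 2)).
set e := mod1 _ in nd *.
set m := Num.floor (alpha * n%:R - (beta + (x + y) / 2)).
move=> e01; rewrite (@mod1_eq _ _ ((x + y) / 2 + e) m); [lra| |lra].
by rewrite /e /mod1 -/m mulrNz -[n%:~R]/(n%:R); ring.
Qed.

(** Take arcs with left endpoints [a_n], [a_m] such that [q < a_n < theta < a_m]. Symbol 1 at [n]
    puts [t] beyond [a_n], or in the piece of that arc wrapped past 0. The wrapped piece of arc [m]
    reaches further, so symbol 0 at [m] rules the latter out. *)
Lemma coding_separates (R : realType) (alpha beta : R) (theta : circle R)
    (q : R) :
  irrational alpha -> 0 < beta < 1 -> 0 <= q < repr theta ->
  exists n m : int,
    [/\ coding alpha beta theta n, ~~ coding alpha beta theta m &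
      forall t : circle R, coding alpha beta t n -> ~~ coding alpha beta t m ->
        q <= repr t].
Proof.
move=> irr b01 qt; have /andP[t0 t1] := circle_repr_itv theta.
(* The bound [repr theta - beta] keeps [theta] inside arc [n]; below, [repr theta + 1 - beta] keeps
   it off the wrapped piece of arc [m]. *)
have [n an] : exists n : int,
    Num.max q (repr theta - beta) < mod1 (- beta - alpha * n%:~R) < repr theta.
  by apply: coding_endpoints_dense; rewrite // ?le_max ?gt_max; lra.
have [m bm] : exists m : int, repr theta < mod1 (- beta - alpha * m%:~R) <
    Num.min 1 (repr theta + 1 - beta).
  by apply: coding_endpoints_dense; rewrite // ?ge_min ?lt_min; lra.
move: an bm; rewrite gt_max lt_min => an bm.
by exists n, m; split=> [||t]; rewrite !codingE//; lra.
Qed.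

(** * From an equivariant Borel map with a Borel left inverse to an isomorphism *)

Lemma unique_invariant_pushforward (R : realType) d1 d2
    (M1 : measurableType d1) (M2 : measurableType d2)
    (mu1 : probability M1 R) (S1 : M1 -> M1)
    (mu2 : probability M2 R) (S2 : M2 -> M2) (phi : M1 -> M2) :
  measure_preserving mu1 S1 -> unique_invariant_probability mu2 S2 ->
  measurable_fun setT phi -> (forall x, phi (S1 x) = S2 (phi x)) ->
  forall B, measurable B -> mu1 (phi @^-1` B) = mu2 B.
Proof.
move=> [_ inv1] [[mS2 _] uniq2] mphi phiS B mB.
pose X : {mfun M1 >-> M2} := mfun_Sub (mem_set mphi).
apply: (uniq2 (distribution mu1 X)) => //; split=> // A mA.
have mphiA : measurable (phi @^-1` A).
  by rewrite -[_ @^-1` _]setTI; apply: (mphi).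
rewrite /= /distribution /pushforward /= -(inv1 _ mphiA).
by congr (mu1 _); apply/funext => x; rewrite /preimage/= phiS.
Qed.

(** The fixed points of [phi \o psi] form the range of [phi]. Images under [phi] are therefore
    traces of [psi]-preimages on this set, and its complement is null because its [phi]-preimage is
    empty. *)
Lemma isomorphic_systems_left_inverse (R : realType) d1 d2
    (M1 : measurableType d1) (M2 : measurableType d2)
    (mu1 : probability M1 R) (S1 : M1 -> M1)
    (mu2 : probability M2 R) (S2 : M2 -> M2)
    (phi : M1 -> M2) (psi : M2 -> M1) :
  measurable_fun setT phi -> measurable_fun setT psi -> cancel phi psi ->
  measurable [set w | phi (psi w) = w] ->
  (forall x, phi (S1 x) = S2 (phi x)) ->
  (forall B, measurable B -> mu1 (phi @^-1` B) = mu2 B) ->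
  isomorphic_systems mu1 S1 mu2 S2.
Proof.
move=> mphi mpsi phiK mN phiS muE.
have imE A : phi @` A = [set w | phi (psi w) = w] `&` psi @^-1` A.
  apply/seteqP; split=> [_ [x Ax <-]|w [/= <-]] /=; rewrite phiK//.
  by exists (psi w).
exists setT, [set w | phi (psi w) = w], phi; split; split.
- by split=> //; rewrite setCT measure0.
- split=> //; first by move=> _ [w <- <-] /=; rewrite -phiS phiK.
  have /= <- := muE _ (measurableC mN).
  rewrite (_ : _ @^-1` _ = set0) ?measure0//.
  by apply/seteqP; split=> x //= []; rewrite phiK.
- split; [by move=> x _ /=; rewrite phiK|exact: in2W (can_inj phiK)|].
  by move=> w /= <-; exists (psi w).
- exact: mphi.
- move=> A mA _; rewrite imE; apply: measurableI => //.
  by rewrite -[_ @^-1` _]setTI; exact: mpsi.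
- by move=> B mB _; rewrite setTI; exact: muE.
- by [].
Qed.

Theorem corollary5p5 (R : realType) (alpha beta : R)
  (alpha01 : 0 < alpha < 1) (alpha_irr : irrational alpha)
  (beta01 : 0 < beta < 1)
  (muI : probability (borel (circle R)) R)
  (muI_unique : unique_invariant_probability muI (rotation alpha))
  (muOmega : probability (borel (sturmian_space alpha beta)) R)
  (muOmega_unique :
    unique_invariant_probability muOmega (@sturmian_shift R alpha beta)) :
  isomorphic_systems muI (rotation alpha)
    muOmega (@sturmian_shift R alpha beta).
Proof.
pose phi (theta : circle R) : sturmian_space alpha beta :=
  exist _ (coding alpha beta theta)
    (mem_set (coding_in_sturmian beta theta alpha_irr)).
pose psi (w : sturmian_space alpha beta) : circle R :=
  \pi_(circle R) (lower_limit_inverse phi repr w).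
have mphi : measurable_fun setT
    (phi : borel (circle R) -> borel (sturmian_space alpha beta)).
  by apply: measurable_sturmian => n; exact: measurable_coding.
have mpsi : measurable_fun setT
    (psi : borel (sturmian_space alpha beta) -> borel (circle R)).
  apply: (@measurability _ _ (borel (sturmian_space alpha beta))
    (borel (circle R)) setT psi (@open (circle R))) => //.
  move=> _ [V oV <-].
  (* Openness of [V] in the quotient topology is openness of its [\pi]-preimage in the reals. *)
  have := @measurable_lower_limit_inverse _ _ _ phi _ (@circle_repr_itv R).
  by move=> /(_ measurableT _ (open_measurable oV)).
have phiK : cancel phi psi.
  move=> theta; rewrite /psi lower_limit_inverseK ?reprK//.
    exact: circle_repr_itv.
  move=> q qt.
  have [q0|q0] := ltP q 0.
    exists setT; split=> // [|t _]; first exact: openT.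
    by have /andP[/(le_trans (ltW q0))] := circle_repr_itv t.
  have [|n [m [tn tm sep]]] :=
      @coding_separates _ alpha beta theta q alpha_irr beta01.
    by rewrite q0.
  exists ([set w | val w n = true] `&` [set w | val w m = false]); split.
  - by apply: openI; exact: open_sturmian_coord.
  - by split=> //=; exact/negbTE.
  - by move=> t /= [tn' tm']; apply: sep => //; rewrite tm'.
apply: (isomorphic_systems_left_inverse mphi mpsi phiK).
(* Equality of sequences is tested on countably many coordinates, each of which is measurable. *)
- rewrite (_ : [set w | _] = ~` (\bigcup_n
      [set w : sturmian_space alpha beta |
        coding alpha beta (psi w) n <> val w n])).
    apply: measurableC; apply: countable_bigcupT_measurable => [|n].
      exact: countableP.
    apply: measurable_neq_bool; last exact: measurable_sturmian_coord.
    exact: measurableT_comp (measurable_coding _ _ _) mpsi.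
  apply/seteqP; split=> w /=.
    by move=> E [n _]; apply; rewrite -[w in RHS]E.
  move=> nw; apply: val_inj; apply/funext => n; apply: contrapT => ne.
  by apply: nw; exists n.
- by move=> theta; apply: val_inj; exact: coding_rotation.
- apply: (unique_invariant_pushforward muI_unique.1 muOmega_unique mphi).
  by move=> theta; apply: val_inj; exact: coding_rotation.
Qed.
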